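(* Let $\Phi$ be a smooth real-valued function on $\mathbf R^3\setminus\{(0,0,0)\}$ and let $A\neq 0$ be a real number. For each $h\ge 0$, let $(\tau_h,\nu_h)$ be the solution to the initial value problem $$\left\{\begin{aligned}&\tau_h'=1+\nu_h\,\Phi(\tau_h,\nu_h,h)\\&\nu_h'=-\tau_h\,\Phi(\tau_h,\nu_h,h)\\&\tau_h(0)=0\\&\nu_h(0)=A.\end{aligned}\right.$$ If $(\tau_0,\nu_0)$ is the constant solution $(0,A)$, then as $h\to 0$, $(\tau_h,\nu_h)\to(\tau_0,\nu_0)$ in the sense of uniform $C^k$-convergence on compact subsets of $\mathbf R$ for each $k$.
   Context: Here $\tau_h,\nu_h$ are real-valued functions of a real variable $s$, and $'$ denotes $\frac{d}{ds}$. *)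

(* Defs.v *)
From Stdlib Require Import Reals.
From Coquelicot Require Import Coquelicot.
Open Scope R_scope.

Definition partial1 (f : R -> R -> R -> R) (x y z : R) : R :=
  Derive (fun t => f t y z) x.
Definition partial2 (f : R -> R -> R -> R) (x y z : R) : R :=
  Derive (fun t => f x t z) y.
Definition partial3 (f : R -> R -> R -> R) (x y z : R) : R :=
  Derive (fun t => f x y t) z.

(** Intended for open [U]: the partial derivatives at a point of [U] then
    depend only on the values of [f] on [U], so the values taken by the total
    function [f] outside [U] are irrelevant. *)
Fixpoint Ck3_on (k : nat) (U : R * R * R -> Prop) (f : R -> R -> R -> R)
  : Prop :=
  (forall x y z : R, U (x, y, z) ->
     continuous (fun p : R * R * R => f (fst (fst p)) (snd (fst p)) (snd p))
       (x, y, z)) /\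
  match k with
  | O => True
  | S k' =>
      (forall x y z : R, U (x, y, z) ->
         ex_derive (fun t => f t y z) x /\
         ex_derive (fun t => f x t z) y /\
         ex_derive (fun t => f x y t) z) /\
      Ck3_on k' U (partial1 f) /\
      Ck3_on k' U (partial2 f) /\
      Ck3_on k' U (partial3 f)
  end.

Definition smooth3_on (U : R * R * R -> Prop) (f : R -> R -> R -> R) : Prop :=
  forall k : nat, Ck3_on k U f.

Definition punctured_space (p : R * R * R) : Prop := p <> (0, 0, 0).

(** [Phi] is only meaningful off the origin, so a solution has to keep
    [(t s, n s, h)] in [punctured_space].  Solutions are global: the equations
    give [(t^2 + n^2)' = 2 t], so they cannot blow up in finite time, and only
    for [h = 0] could a maximal solution stop, by reaching the origin. *)
Definition is_solution (Phi : R -> R -> R -> R) (A h : R) (t n : R -> R)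
  : Prop :=
  (forall s : R,
     punctured_space (t s, n s, h) /\
     is_derive t s (1 + n s * Phi (t s) (n s) h) /\
     is_derive n s (- t s * Phi (t s) (n s) h)) /\
  t 0 = 0 /\
  n 0 = A.

Definition is_Ck (k : nat) (f : R -> R) : Prop :=
  forall (j : nat) (s : R), (j <= k)%nat ->
    ex_derive_n f j s /\ continuous (Derive_n f j) s.

(** As [h] tends to [h0] within [D], the functions [f h] converge to [g] in
    [C^k], uniformly on compact subsets of the line. *)
Definition Ck_cvg_on_compacts (k : nat) (D : R -> Prop) (h0 : R)
    (f : R -> R -> R) (g : R -> R) : Prop :=
  (forall h : R, D h -> is_Ck k (f h)) /\
  is_Ck k g /\
  forall (K : R -> Prop) (eps : R), compact K -> 0 < eps ->
    within D (locally h0) (fun h : R =>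
      forall (j : nat) (s : R), (j <= k)%nat -> K s ->
        Rabs (Derive_n (f h) j s - Derive_n g j s) < eps).

(* Main.v *)
Require Import Defs.
From Stdlib Require Import Reals Lra Lia.
From Coquelicot Require Import Coquelicot.
Open Scope R_scope.

(** The system is a vector field [(F, G)] on the plane depending on a
    parameter [h], with [F = 1 + y Phi] and [G = - x Phi]; that the solution at
    [h = 0] is constant says that [(0, A)] is an equilibrium of the field with
    parameter [0].  The statement holds for any such family of fields that is
    smooth in [(x, y, h)] jointly, and is proved in that generality
    ([Ck_cvg_to_equilibrium]).

    Uniform convergence comes from Gronwall's inequality applied to the squared
    distance from [(x, y, h)] to the equilibrium [(a, b, h0)],
    [u = (x - a)^2 + (y - b)^2 + (h - h0)^2].  Since [F] and [G] vanish at
    [(a, b, h0)] and are Lipschitz near it, [|u'| <= C u] as long as the curve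
    stays in a fixed box around the equilibrium.  As [u 0 = (h - h0)^2], the
    bound [u s <= (h - h0)^2 exp (C T)] for [|s| <= T] keeps the curve inside
    the box when [h] is close to [h0], and then tends to [0]
    ([uniform_convergence_to_equilibrium]).

    Higher derivatives need no further estimate.  By the chain rule the [j]-th
    derivative of [P (x s) (y s) h] along a solution is again a smooth function
    of [(x s, y s, h)], namely the [j]-fold Lie derivative of [P] along
    [(F, G)] ([Derive_n_integral_curve]); its continuity at [(a, b, h0)] turns
    uniform convergence of the curves into uniform convergence of their
    derivatives. *)

(** * Functions of class C^k in three variables *)

Lemma locally_open_axes (U : R * R * R -> Prop) (x y z : R) :
  open U -> U (x, y, z) ->
  locally x (fun t => U (t, y, z)) /\
  locally y (fun t => U (x, t, z)) /\
  locally z (fun t => U (x, y, t)).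
Proof.
  intros HU Hp.
  destruct (HU _ Hp) as [e He].
  repeat split; exists e; intros t Ht; apply He;
    repeat split; simpl; try exact Ht; apply ball_center.
Qed.

Lemma Ck3_on_continuous k U f x y z :
  Ck3_on k U f -> U (x, y, z) ->
  continuous (fun p : R * R * R => f (fst (fst p)) (snd (fst p)) (snd p))
    (x, y, z).
Proof. destruct k; intros [H _]; apply H. Qed.

(** The sum and product rules for partial derivatives hold only on [U], so every
    closure property below identifies a partial derivative through this
    lemma.  Openness of [U] is what makes the partial derivatives of [f] and
    [g] agree on [U] as well. *)
Lemma Ck3_on_ext k : forall (U : R * R * R -> Prop) (f g : R -> R -> R -> R),
  open U -> (forall x y z, U (x, y, z) -> f x y z = g x y z) ->
  Ck3_on k U f -> Ck3_on k U g.
Proof.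
  induction k as [|k IH]; intros U f g HU Hfg [Hc Hd]; split.
  2: exact I.
  1, 2: intros x y z Hp; eapply continuous_ext_loc; [|apply Hc, Hp];
    destruct (HU _ Hp) as [e He]; exists e; intros [[u v] w] Hq;
    apply Hfg, He, Hq.
  destruct Hd as (Hex & H1 & H2 & H3).
  assert (Hax : forall x y z, U (x, y, z) ->
    locally x (fun t => f t y z = g t y z) /\
    locally y (fun t => f x t z = g x t z) /\
    locally z (fun t => f x y t = g x y t)).
  { intros x y z Hp.
    destruct (locally_open_axes U x y z HU Hp) as (L1 & L2 & L3).
    split; [|split];
      [revert L1|revert L2|revert L3]; apply filter_imp; intros t; apply Hfg. }
  split.
  - intros x y z Hp.
    destruct (Hex x y z Hp) as (E1 & E2 & E3).
    destruct (Hax x y z Hp) as (L1 & L2 & L3).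
    repeat split.
    + apply (ex_derive_ext_loc _ _ _ L1 E1).
    + apply (ex_derive_ext_loc _ _ _ L2 E2).
    + apply (ex_derive_ext_loc _ _ _ L3 E3).
  - split; [|split].
    + apply (IH U (partial1 f)); trivial; intros x y z Hp.
      apply Derive_ext_loc, (Hax x y z Hp).
    + apply (IH U (partial2 f)); trivial; intros x y z Hp.
      apply Derive_ext_loc, (Hax x y z Hp).
    + apply (IH U (partial3 f)); trivial; intros x y z Hp.
      apply Derive_ext_loc, (Hax x y z Hp).
Qed.

(** In the Leibniz rule each factor also appears undifferentiated, where it is
    needed in class one less than it is known to be in. *)
Lemma Ck3_on_lower k : forall (U : R * R * R -> Prop) f,
  Ck3_on (S k) U f -> Ck3_on k U f.
Proof.
  induction k as [|k IH]; intros U f [Hc Hd]; split; trivial.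
  destruct Hd as (Hex & H1 & H2 & H3); auto.
Qed.

Lemma Ck3_on_plus k : forall (U : R * R * R -> Prop) f g,
  open U -> Ck3_on k U f -> Ck3_on k U g ->
  Ck3_on k U (fun x y z => f x y z + g x y z).
Proof.
  induction k as [|k IH]; intros U f g HU Hf Hg;
    (split;
     [ intros x y z Hp;
       apply (continuous_plus (K := R_AbsRing) (V := R_NormedModule));
       [apply (Ck3_on_continuous _ _ _ _ _ _ Hf Hp)
       |apply (Ck3_on_continuous _ _ _ _ _ _ Hg Hp)] | ]).
  - exact I.
  - destruct Hf as (_ & Ef & F1 & F2 & F3), Hg as (_ & Eg & G1 & G2 & G3).
    split.
    { intros x y z Hp.
      destruct (Ef x y z Hp) as (? & ? & ?), (Eg x y z Hp) as (? & ? & ?).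
      repeat split; apply (ex_derive_plus (V := R_NormedModule)); trivial. }
    split; [|split].
    + refine (Ck3_on_ext _ _ _ _ HU _ (IH U _ _ HU F1 G1)).
      intros x y z Hp; symmetry; unfold partial1;
        apply (Derive_plus (fun t => f t y z) (fun t => g t y z));
        [apply (Ef x y z Hp)|apply (Eg x y z Hp)].
    + refine (Ck3_on_ext _ _ _ _ HU _ (IH U _ _ HU F2 G2)).
      intros x y z Hp; symmetry; unfold partial2;
        apply (Derive_plus (fun t => f x t z) (fun t => g x t z));
        [apply (Ef x y z Hp)|apply (Eg x y z Hp)].
    + refine (Ck3_on_ext _ _ _ _ HU _ (IH U _ _ HU F3 G3)).
      intros x y z Hp; symmetry; unfold partial3;
        apply (Derive_plus (fun t => f x y t) (fun t => g x y t));
        [apply (Ef x y z Hp)|apply (Eg x y z Hp)].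
Qed.

Lemma Ck3_on_mult k : forall (U : R * R * R -> Prop) f g,
  open U -> Ck3_on k U f -> Ck3_on k U g ->
  Ck3_on k U (fun x y z => f x y z * g x y z).
Proof.
  induction k as [|k IH]; intros U f g HU Hf Hg;
    (split;
     [ intros x y z Hp;
       apply (continuous_mult (K := R_AbsRing));
       [apply (Ck3_on_continuous _ _ _ _ _ _ Hf Hp)
       |apply (Ck3_on_continuous _ _ _ _ _ _ Hg Hp)] | ]).
  - exact I.
  - assert (Lf := Ck3_on_lower _ _ _ Hf); assert (Lg := Ck3_on_lower _ _ _ Hg).
    destruct Hf as (_ & Ef & F1 & F2 & F3), Hg as (_ & Eg & G1 & G2 & G3).
    split.
    { intros x y z Hp.
      destruct (Ef x y z Hp) as (? & ? & ?), (Eg x y z Hp) as (? & ? & ?).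
      repeat split; apply ex_derive_mult; trivial. }
    split; [|split].
    + refine (Ck3_on_ext _ _ _ _ HU _ (Ck3_on_plus _ U _ _ HU
         (IH U _ _ HU F1 Lg) (IH U _ _ HU Lf G1))).
      intros x y z Hp; symmetry; unfold partial1;
        apply (Derive_mult (fun t => f t y z) (fun t => g t y z));
        [apply (Ef x y z Hp)|apply (Eg x y z Hp)].
    + refine (Ck3_on_ext _ _ _ _ HU _ (Ck3_on_plus _ U _ _ HU
         (IH U _ _ HU F2 Lg) (IH U _ _ HU Lf G2))).
      intros x y z Hp; symmetry; unfold partial2;
        apply (Derive_mult (fun t => f x t z) (fun t => g x t z));
        [apply (Ef x y z Hp)|apply (Eg x y z Hp)].
    + refine (Ck3_on_ext _ _ _ _ HU _ (Ck3_on_plus _ U _ _ HU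
         (IH U _ _ HU F3 Lg) (IH U _ _ HU Lf G3))).
      intros x y z Hp; symmetry; unfold partial3;
        apply (Derive_mult (fun t => f x y t) (fun t => g x y t));
        [apply (Ef x y z Hp)|apply (Eg x y z Hp)].
Qed.

Lemma Ck3_on_const k : forall (U : R * R * R -> Prop) c,
  open U -> Ck3_on k U (fun _ _ _ => c).
Proof.
  induction k as [|k IH]; intros U c HU;
    (split; [intros; apply continuous_const|]).
  - exact I.
  - split; [intros; repeat split; apply ex_derive_const|].
    repeat split; refine (Ck3_on_ext _ _ _ _ HU _ (IH U 0 HU));
      intros; symmetry; apply (Derive_const c).
Qed.

Lemma Ck3_on_fst k (U : R * R * R -> Prop) :
  open U -> Ck3_on k U (fun x _ _ => x).
Proof.
  intros HU; destruct k as [|k];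
    (split; [intros; apply (continuous_comp fst fst);
       [apply continuous_fst | apply continuous_fst]|]).
  - exact I.
  - split; [intros x y z _; split; [exact (ex_derive_id x)
            |split; exact (ex_derive_const x _)]|].
    split; [|split].
    + refine (Ck3_on_ext _ _ _ _ HU _ (Ck3_on_const k U 1 HU)).
      intros x y z _; symmetry; apply Derive_id.
    + refine (Ck3_on_ext _ _ _ _ HU _ (Ck3_on_const k U 0 HU)).
      intros x y z _; symmetry; apply (Derive_const x).
    + refine (Ck3_on_ext _ _ _ _ HU _ (Ck3_on_const k U 0 HU)).
      intros x y z _; symmetry; apply (Derive_const x).
Qed.

Lemma Ck3_on_snd k (U : R * R * R -> Prop) :
  open U -> Ck3_on k U (fun _ y _ => y).
Proof.
  intros HU; destruct k as [|k];
    (split; [intros; apply (continuous_comp fst snd);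
       [apply continuous_fst | apply continuous_snd]|]).
  - exact I.
  - split; [intros x y z _; split; [exact (ex_derive_const y _)
            |split; [exact (ex_derive_id y)|exact (ex_derive_const y _)]]|].
    split; [|split].
    + refine (Ck3_on_ext _ _ _ _ HU _ (Ck3_on_const k U 0 HU)).
      intros x y z _; symmetry; apply (Derive_const y).
    + refine (Ck3_on_ext _ _ _ _ HU _ (Ck3_on_const k U 1 HU)).
      intros x y z _; symmetry; apply Derive_id.
    + refine (Ck3_on_ext _ _ _ _ HU _ (Ck3_on_const k U 0 HU)).
      intros x y z _; symmetry; apply (Derive_const y).
Qed.

Lemma open_punctured_space : open punctured_space.
Proof.
  apply (open_ext (fun p : R * R * R =>
    (fst (fst p) <> 0 \/ snd (fst p) <> 0) \/ snd p <> 0)).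
  - intros [[x y] z]; unfold punctured_space; simpl; split.
    + intros [[H|H]|H] E; injection E; intros; contradiction.
    + intros H.
      destruct (Req_dec x 0) as [->|]; [|tauto].
      destruct (Req_dec y 0) as [->|]; [|tauto].
      destruct (Req_dec z 0) as [->|]; [|tauto].
      now contradict H.
  - apply open_or; [apply open_or|].
    + apply (open_comp (fun p : R * R * R => fst (fst p)) (fun t => t <> 0)).
      2: apply open_neq.
      intros p _; apply (continuous_comp fst fst);
        [apply continuous_fst | apply continuous_fst].
    + apply (open_comp (fun p : R * R * R => snd (fst p)) (fun t => t <> 0)).
      2: apply open_neq.
      intros p _; apply (continuous_comp fst snd);
        [apply continuous_fst | apply continuous_snd].
    + apply (open_comp (fun p : R * R * R => snd p) (fun t => t <> 0)).
      2: apply open_neq.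
      intros p _; apply continuous_snd.
Qed.

(** * Derivatives along an integral curve *)

(** The field has no component in the direction of the parameter [z], which is
    constant along each solution; hence no third partial derivative. *)

Definition lie_derivative (F G P : R -> R -> R -> R) (x y z : R) : R :=
  partial1 P x y z * F x y z + partial2 P x y z * G x y z.

Fixpoint iter_lie (F G P : R -> R -> R -> R) (j : nat) : R -> R -> R -> R :=
  match j with
  | O => P
  | S j => lie_derivative F G (iter_lie F G P j)
  end.

Lemma smooth3_on_iter_lie U F G P :
  open U -> smooth3_on U F -> smooth3_on U G -> smooth3_on U P ->
  forall j, smooth3_on U (iter_lie F G P j).
Proof.
  intros HU HF HG HP j; induction j as [|j IH]; trivial.
  intros k; destruct (IH (S k)) as (_ & _ & H1 & H2 & _).
  apply Ck3_on_plus; trivial; apply Ck3_on_mult; trivial.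
Qed.

(** Continuity of one partial derivative, with mere existence of the other,
    already gives total differentiability in the first two variables, which is
    what the chain rule needs. *)
Lemma is_derive_along (U : R * R * R -> Prop) f (x y : R -> R) z s dx dy :
  open U -> Ck3_on 1 U f -> U (x s, y s, z) ->
  is_derive x s dx -> is_derive y s dy ->
  is_derive (fun s => f (x s) (y s) z) s
    (partial1 f (x s) (y s) z * dx + partial2 f (x s) (y s) z * dy).
Proof.
  intros HU Hf Hp Hx Hy.
  apply is_derive_Reals.
  apply (derivable_pt_lim_comp_2d (fun u v => f u v z));
    [|apply is_derive_Reals, Hx|apply is_derive_Reals, Hy].
  apply filterdiff_differentiable_pt_lim.
  destruct Hf as (_ & Ef & H1 & _).
  apply (is_derive_filterdiff (fun u v => f u v z) _ _
    (fun u v => partial1 f u v z)).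
  - destruct (HU _ Hp) as [e He]; exists e; intros [u v] Hq.
    apply Derive_correct, (Ef u v z), He; split; [exact Hq|apply ball_center].
  - apply Derive_correct, (Ef _ _ _ Hp).
  - apply (continuous_comp (fun u : R * R => (u, z))
      (fun p : R * R * R => partial1 f (fst (fst p)) (snd (fst p)) (snd p))).
    + apply (continuous_comp_2 (fun u : R * R => u) (fun _ => z)
        (fun u z => (u, z))).
      * apply continuous_id.
      * apply continuous_const.
      * eapply continuous_ext; [|apply continuous_id].
        intros []; reflexivity.
    + apply (Ck3_on_continuous _ _ _ _ _ _ H1 Hp).
Qed.

Definition integral_curve (U : R * R * R -> Prop) (F G : R -> R -> R -> R)
    (h : R) (x y : R -> R) : Prop :=
  forall s, U (x s, y s, h) /\
    is_derive x s (F (x s) (y s) h) /\ is_derive y s (G (x s) (y s) h).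

Lemma is_derive_integral_curve U F G P h x y s :
  open U -> smooth3_on U P -> integral_curve U F G h x y ->
  is_derive (fun s => P (x s) (y s) h) s
    (lie_derivative F G P (x s) (y s) h).
Proof.
  intros HU HP Hc; destruct (Hc s) as (Hp & Hx & Hy).
  exact (is_derive_along U P x y h s _ _ HU (HP 1%nat) Hp Hx Hy).
Qed.

Lemma Derive_n_integral_curve U F G P h x y :
  open U -> smooth3_on U F -> smooth3_on U G -> smooth3_on U P ->
  integral_curve U F G h x y ->
  forall j s, Derive_n (fun s => P (x s) (y s) h) j s
              = iter_lie F G P j (x s) (y s) h.
Proof.
  intros HU HF HG HP Hc j; induction j as [|j IH]; intros s; [reflexivity|].
  simpl; rewrite (Derive_ext _ _ _ IH).
  apply is_derive_unique, (is_derive_integral_curve U F G (iter_lie F G P j));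
    trivial.
  apply smooth3_on_iter_lie; trivial.
Qed.

Lemma is_Ck_integral_curve U F G P h x y k :
  open U -> smooth3_on U F -> smooth3_on U G -> smooth3_on U P ->
  integral_curve U F G h x y -> is_Ck k (fun s => P (x s) (y s) h).
Proof.
  intros HU HF HG HP Hc.
  assert (E : forall j s, ex_derive (Derive_n (fun s => P (x s) (y s) h) j) s).
  { intros j s.
    apply ex_derive_ext with (fun s => iter_lie F G P j (x s) (y s) h).
    - intros t; symmetry; apply (Derive_n_integral_curve U); trivial.
    - eexists; apply (is_derive_integral_curve U F G (iter_lie F G P j) h x y);
        trivial; apply smooth3_on_iter_lie; trivial. }
  intros j s _; split.
  - destruct j; [exact I | apply E].
  - apply (ex_derive_continuous (K := R_AbsRing) (V := R_NormedModule)), E.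
Qed.

(** * Local Lipschitz bound *)

Lemma locally_pair3 (P : R * R * R -> Prop) a b c :
  locally (a, b, c) P ->
  exists r, 0 < r /\ forall x y z,
    Rabs (x - a) < r -> Rabs (y - b) < r -> Rabs (z - c) < r -> P (x, y, z).
Proof.
  intros [e He]; exists e; split; [apply cond_pos|].
  intros x y z Hx Hy Hz; apply He; repeat split; assumption.
Qed.

Lemma continuous_near f (a b c : R) :
  continuous (fun p : R * R * R => f (fst (fst p)) (snd (fst p)) (snd p))
    (a, b, c) ->
  forall eps, 0 < eps -> exists r, 0 < r /\ forall x y z,
    Rabs (x - a) < r -> Rabs (y - b) < r -> Rabs (z - c) < r ->
    Rabs (f x y z - f a b c) < eps.
Proof.
  intros Hc eps Heps.
  apply (locally_pair3
    (fun p => Rabs (f (fst (fst p)) (snd (fst p)) (snd p) - f a b c) < eps)).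
  apply (Hc (fun v => Rabs (v - f a b c) < eps)).
  exists (mkposreal eps Heps); intros y Hy; exact Hy.
Qed.

Lemma MVT_bound f a r M :
  (forall t, Rabs (t - a) < r -> ex_derive f t /\ Rabs (Derive f t) <= M) ->
  forall t, Rabs (t - a) < r -> Rabs (f t - f a) <= M * Rabs (t - a).
Proof.
  intros Hf t Ht.
  destruct (MVT_cor4 f (Derive f) a (Rabs (t - a))) with (b := t)
    as (c & -> & Hc); [|apply Rle_refl|].
  - intros c Hc; apply Derive_correct, Hf; lra.
  - rewrite Rabs_mult; apply Rmult_le_compat_r; [apply Rabs_pos|].
    apply Hf; lra.
Qed.

(** The path from [(a, b, c)] to [(x, y, z)] parallel to the axes stays in a box
    on which the three partial derivatives exceed their values at [(a, b, c)]
    by at most [1] in absolute value; the mean value inequality applies on each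
    of its three segments. *)
Lemma Ck3_on_locally_lipschitz U f a b c :
  open U -> Ck3_on 1 U f -> U (a, b, c) ->
  exists r L, 0 < r /\ 0 <= L /\ forall x y z,
    Rabs (x - a) < r -> Rabs (y - b) < r -> Rabs (z - c) < r ->
    Rabs (f x y z - f a b c)
    <= L * (Rabs (x - a) + Rabs (y - b) + Rabs (z - c)).
Proof.
  intros HU (_ & Ef & H1 & H2 & H3) Hp.
  destruct (locally_pair3 U a b c (HU _ Hp)) as (r0 & Hr0 & HrU).
  destruct (continuous_near _ _ _ _ (proj1 H1 a b c Hp) 1 Rlt_0_1)
    as (r1 & Hr1 & B1).
  destruct (continuous_near _ _ _ _ (proj1 H2 a b c Hp) 1 Rlt_0_1)
    as (r2 & Hr2 & B2).
  destruct (continuous_near _ _ _ _ (proj1 H3 a b c Hp) 1 Rlt_0_1)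
    as (r3 & Hr3 & B3).
  set (r := Rmin (Rmin r0 r1) (Rmin r2 r3)).
  assert (Hr : 0 < r) by (repeat apply Rmin_pos; trivial).
  assert (L0 : r <= r0) by
    (eapply Rle_trans; [apply Rmin_l|apply Rmin_l]).
  assert (L1 : r <= r1) by
    (eapply Rle_trans; [apply Rmin_l|apply Rmin_r]).
  assert (L2 : r <= r2) by
    (eapply Rle_trans; [apply Rmin_r|apply Rmin_l]).
  assert (L3 : r <= r3) by
    (eapply Rle_trans; [apply Rmin_r|apply Rmin_r]).
  clearbody r.
  set (M1 := Rabs (partial1 f a b c) + 1).
  set (M2 := Rabs (partial2 f a b c) + 1).
  set (M3 := Rabs (partial3 f a b c) + 1).
  assert (P1 := Rabs_pos (partial1 f a b c)).
  assert (P2 := Rabs_pos (partial2 f a b c)).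
  assert (P3 := Rabs_pos (partial3 f a b c)).
  assert (HM1 : 0 <= M1) by (unfold M1; lra).
  assert (HM2 : 0 <= M2) by (unfold M2; lra).
  assert (HM3 : 0 <= M3) by (unfold M3; lra).
  assert (Haa : Rabs (a - a) < r) by (rewrite Rminus_diag, Rabs_R0; exact Hr).
  assert (Hbb : Rabs (b - b) < r) by (rewrite Rminus_diag, Rabs_R0; exact Hr).
  exists r, (M1 + M2 + M3); split; [exact Hr|split; [lra|]].
  intros x y z Hx Hy Hz.
  assert (D1 : Rabs (f x y z - f a y z) <= M1 * Rabs (x - a)).
  { apply (MVT_bound (fun t => f t y z) a r); [|exact Hx].
    intros t Ht; split; [apply (Ef t y z), HrU; lra|].
    assert (B := B1 t y z ltac:(lra) ltac:(lra) ltac:(lra)).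
    assert (Q := Rabs_triang_inv (partial1 f t y z) (partial1 f a b c)).
    change (Rabs (partial1 f t y z) <= M1); unfold M1; lra. }
  assert (D2 : Rabs (f a y z - f a b z) <= M2 * Rabs (y - b)).
  { apply (MVT_bound (fun t => f a t z) b r); [|exact Hy].
    intros t Ht; split; [apply (Ef a t z), HrU; lra|].
    assert (B := B2 a t z ltac:(lra) ltac:(lra) ltac:(lra)).
    assert (Q := Rabs_triang_inv (partial2 f a t z) (partial2 f a b c)).
    change (Rabs (partial2 f a t z) <= M2); unfold M2; lra. }
  assert (D3 : Rabs (f a b z - f a b c) <= M3 * Rabs (z - c)).
  { apply (MVT_bound (fun t => f a b t) c r); [|exact Hz].
    intros t Ht; split; [apply (Ef a b t), HrU; lra|].
    assert (B := B3 a b t ltac:(lra) ltac:(lra) ltac:(lra)).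
    assert (Q := Rabs_triang_inv (partial3 f a b t) (partial3 f a b c)).
    change (Rabs (partial3 f a b t) <= M3); unfold M3; lra. }
  assert (T1 := Rabs_triang (f x y z - f a y z) (f a y z - f a b c)).
  assert (T2 := Rabs_triang (f a y z - f a b z) (f a b z - f a b c)).
  replace (f x y z - f a y z + (f a y z - f a b c))
    with (f x y z - f a b c) in T1 by ring.
  replace (f a y z - f a b z + (f a b z - f a b c))
    with (f a y z - f a b c) in T2 by ring.
  assert (X1 := Rabs_pos (x - a)).
  assert (X2 := Rabs_pos (y - b)).
  assert (X3 := Rabs_pos (z - c)).
  assert (Y1 := Rmult_le_pos _ _ (Rplus_le_le_0_compat _ _ HM2 HM3) X1).
  assert (Y2 := Rmult_le_pos _ _ (Rplus_le_le_0_compat _ _ HM1 HM3) X2).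
  assert (Y3 := Rmult_le_pos _ _ (Rplus_le_le_0_compat _ _ HM1 HM2) X3).
  clearbody M1 M2 M3; lra.
Qed.

(** * Gronwall estimate *)

Lemma continuous_lt_ball u s c :
  continuous u s -> u s < c ->
  exists d, 0 < d /\ forall t, Rabs (t - s) < d -> u t < c.
Proof.
  intros Hu Hs.
  destruct (Hu (fun v => v < c) (open_lt c _ Hs)) as [d Hd].
  exists d; split; [apply cond_pos|exact Hd].
Qed.

Lemma continuous_gt_ball u s c :
  continuous u s -> c < u s ->
  exists d, 0 < d /\ forall t, Rabs (t - s) < d -> c < u t.
Proof.
  intros Hu Hs.
  destruct (Hu (fun v => c < v) (open_gt c _ Hs)) as [d Hd].
  exists d; split; [apply cond_pos|exact Hd].
Qed.

(** Continuous induction: the set of times up to which the weak bound holds is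
    closed, and the step hypothesis, which improves the weak bound to a strict
    one, makes it open in [[0, T]]. *)
Lemma barrier u c T :
  0 <= T -> (forall s, continuous u s) -> u 0 < c ->
  (forall s, 0 <= s <= T -> (forall t, 0 <= t <= s -> u t <= c) -> u s < c) ->
  forall s, 0 <= s <= T -> u s <= c.
Proof.
  intros HT Hc H0 Hstep.
  set (E := fun s => 0 <= s <= T /\ forall t, 0 <= t <= s -> u t <= c).
  assert (E0 : E 0).
  { split; [lra|]; intros t Ht; replace t with 0 by lra; lra. }
  destruct (completeness E) as [S [Sub Slub]].
  { exists T; intros s [Hs _]; lra. }
  { exists 0; exact E0. }
  assert (HS0 : 0 <= S) by (apply Sub, E0).
  assert (HST : S <= T) by (apply Slub; intros s [Hs _]; lra).
  (* Otherwise [t] would bound from above the set with supremum [S]. *)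
  assert (Hbelow : forall t, 0 <= t < S -> u t <= c).
  { intros t Ht; destruct (Rle_lt_dec (u t) c) as [|Hgt]; trivial.
    assert (S <= t); [|lra].
    apply Slub; intros s [Hs Hsc].
    destruct (Rle_lt_dec s t) as [|Hlt]; trivial.
    specialize (Hsc t ltac:(lra)); lra. }
  assert (HS : u S <= c).
  { destruct (Rle_lt_dec (u S) c) as [|Hgt]; trivial.
    destruct (Req_dec S 0) as [E1|N]; [rewrite E1 in Hgt; lra|].
    destruct (continuous_gt_ball u S c (Hc S) Hgt) as (d & Hd & Hball).
    set (t := Rmax 0 (S - d / 2)).
    assert (Ht : 0 <= t < S /\ S - d / 2 <= t).
    { repeat split; [apply Rmax_l|apply Rmax_lub_lt; lra|apply Rmax_r]. }
    assert (B : u t <= c) by (apply Hbelow, Ht).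
    assert (c < u t); [|lra].
    apply Hball; rewrite Rabs_minus_sym, Rabs_pos_eq; lra. }
  assert (HSE : forall t, 0 <= t <= S -> u t <= c).
  { intros t Ht; destruct (Req_dec t S) as [->|]; trivial.
    apply Hbelow; lra. }
  destruct (continuous_lt_ball u S c (Hc S) (Hstep S (conj HS0 HST) HSE))
    as (d & Hd & Hball).
  assert (HEq : S = T).
  { destruct (Req_dec S T) as [|N]; trivial.
    set (t := Rmin T (S + d / 2)).
    assert (Ht : S < t /\ t <= T /\ t <= S + d / 2).
    { repeat split; [apply Rmin_glb_lt; lra|apply Rmin_l|apply Rmin_r]. }
    assert (t <= S); [|lra].
    apply Sub; split; [lra|].
    intros t' Ht'; destruct (Rle_lt_dec t' S); [apply HSE; lra|].
    apply Rlt_le, Hball; rewrite Rabs_pos_eq; lra. }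
  rewrite <- HEq; exact HSE.
Qed.

Lemma exp_nondecreasing v w : v <= w -> exp v <= exp w.
Proof.
  intros [H| ->]; [apply Rlt_le, exp_increasing, H|apply Rle_refl].
Qed.

(** The differential inequality is only available below the level [c].  While
    [u <= c], the function [u s * exp (- C s)] is nonincreasing, so [u] is at
    most [u 0 * exp (C T)], which is strictly below [c]; by [barrier] the level
    [c] is therefore never exceeded. *)
Lemma gronwall_forward (u du : R -> R) C c T :
  0 <= C -> 0 <= T -> (forall s, is_derive u s (du s)) ->
  (forall s, u s <= c -> du s <= C * u s) ->
  0 <= u 0 -> u 0 * exp (C * T) < c ->
  forall s, 0 <= s <= T -> u s <= u 0 * exp (C * T).
Proof.
  intros HC HT Hd Hdu Hu0 Hc.
  assert (Hgr : forall s, 0 <= s <= T -> (forall t, 0 <= t <= s -> u t <= c) ->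
                u s <= u 0 * exp (C * T)).
  { intros s Hs Hle.
    apply Rle_trans with (u 0 * exp (C * s)).
    2: { apply Rmult_le_compat_l; trivial.
         apply exp_nondecreasing, Rmult_le_compat_l; lra. }
    destruct (Req_dec s 0) as [->|N].
    { rewrite Rmult_0_r, exp_0; lra. }
    destruct (MVT_cor2 (fun t => u t * exp (- (C * t)))
      (fun t => (du t - C * u t) * exp (- (C * t))) 0 s) as (t & Ht & Hts).
    - lra.
    - intros t _; apply is_derive_Reals; auto_derive.
      + exists (du t); apply Hd.
      + replace (Derive (fun v => u v) t) with (du t)
          by (symmetry; apply is_derive_unique, Hd); ring.
    - rewrite Rmult_0_r, Ropp_0, exp_0, Rmult_1_r in Ht.
      assert (Hut := Hdu t (Hle t ltac:(lra))).
      assert (Hneg : 0 <= (C * u t - du t) * exp (- (C * t)) * (s - 0)).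
      { repeat apply Rmult_le_pos; try lra; apply Rlt_le, exp_pos. }
      assert (Hv : u s * exp (- (C * s)) <= u 0) by lra.
      replace (u s) with (u s * exp (- (C * s)) * exp (C * s)).
      + apply Rmult_le_compat_r; [apply Rlt_le, exp_pos|exact Hv].
      + rewrite Rmult_assoc, <- exp_plus, Rplus_opp_l, exp_0; ring. }
  intros s Hs; apply Hgr; trivial.
  intros t Ht; apply (barrier u c T); trivial; try lra.
  - intros v.
    apply (ex_derive_continuous (K := R_AbsRing) (V := R_NormedModule)).
    exists (du v); apply Hd.
  - apply Rle_lt_trans with (2 := Hc).
    rewrite <- (Rmult_1_r (u 0)) at 1; apply Rmult_le_compat_l; trivial.
    rewrite <- exp_0; apply exp_nondecreasing, Rmult_le_pos; trivial.
  - intros v Hv Hle; apply Rle_lt_trans with (2 := Hc); auto.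
Qed.

(** The two-sided bound on [du] is invariant under [s |-> - s], so negative times
    reduce to positive ones. *)
Lemma gronwall (u du : R -> R) C c T :
  0 <= C -> 0 <= T -> (forall s, is_derive u s (du s)) ->
  (forall s, u s <= c -> Rabs (du s) <= C * u s) ->
  0 <= u 0 -> u 0 * exp (C * T) < c ->
  forall s, Rabs s <= T -> u s <= u 0 * exp (C * T).
Proof.
  intros HC HT Hd Hdu Hu0 Hc s Hs.
  destruct (Rle_lt_dec 0 s) as [Hpos|Hneg].
  - apply (gronwall_forward u du C c T); trivial.
    + intros t Ht; apply Rle_trans with (1 := Rle_abs _), Hdu, Ht.
    + rewrite Rabs_pos_eq in Hs; lra.
  - rewrite Rabs_left in Hs by exact Hneg.
    rewrite <- (Ropp_involutive s), <- Ropp_0 at 1.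
    apply (gronwall_forward (fun t => u (- t)) (fun t => - du (- t)) C c T);
      trivial.
    + intros t; auto_derive; [exists (du (- t)); apply Hd|].
      replace (Derive (fun v => u v) (- t)) with (du (- t))
        by (symmetry; apply is_derive_unique, Hd); ring.
    + intros t Ht; apply Rle_trans with (Rabs (du (- t))).
      * rewrite <- Rabs_Ropp; apply Rle_abs.
      * apply Hdu, Ht.
    + rewrite Ropp_0; exact Hu0.
    + rewrite Ropp_0; exact Hc.
    + lra.
Qed.

(** * Convergence to an equilibrium *)

(** Including [(h - h0)^2] in [u] absorbs the dependence of the field on the
    parameter: the inequality for [u'] is then homogeneous, and the smallness of
    [u 0] is the only place where [h] being close to [h0] enters. *)
Lemma uniform_convergence_to_equilibrium (U : R * R * R -> Prop) F G
    (D : R -> Prop) (a b h0 : R) (x y : R -> R -> R) :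
  open U -> Ck3_on 1 U F -> Ck3_on 1 U G -> U (a, b, h0) ->
  F a b h0 = 0 -> G a b h0 = 0 ->
  (forall h, D h -> integral_curve U F G h (x h) (y h)) ->
  (forall h, D h -> x h 0 = a /\ y h 0 = b) ->
  forall T r, 0 <= T -> 0 < r ->
  within D (locally h0) (fun h => forall s, Rabs s <= T ->
    Rabs (x h s - a) < r /\ Rabs (y h s - b) < r /\ Rabs (h - h0) < r).
Proof.
  intros HU HF HG Hp F0 G0 Hcurve Hinit T r HT Hr.
  destruct (Ck3_on_locally_lipschitz U F a b h0 HU HF Hp)
    as (rF & LF & HrF & HLF & BF).
  destruct (Ck3_on_locally_lipschitz U G a b h0 HU HG Hp)
    as (rG & LG & HrG & HLG & BG).
  set (rho := Rmin r (Rmin rF rG)).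
  assert (Hrho : 0 < rho) by (repeat apply Rmin_pos; trivial).
  assert (R1 : rho <= r) by apply Rmin_l.
  assert (R2 : rho <= rF) by (eapply Rle_trans; [apply Rmin_r|apply Rmin_l]).
  assert (R3 : rho <= rG) by (eapply Rle_trans; [apply Rmin_r|apply Rmin_r]).
  clearbody rho.
  (* With [S] the sum of the three coordinate distances, [|u'|] is at most
     [2 (LF + LG) S^2], and [S^2 <= 3 u] by Cauchy-Schwarz. *)
  set (C := 6 * (LF + LG)).
  assert (HC : 0 <= C) by (unfold C; lra).
  set (K := exp (C * T)).
  assert (HK : 0 < K) by apply exp_pos.
  (* Strictly below [rho^2], so that [u <= c] puts each coordinate strictly
     inside the box. *)
  set (c := rho * rho / 2).
  assert (Hc : 0 < c) by (unfold c; nra).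
  assert (Hd : 0 < Rmin 1 (c / K)).
  { apply Rmin_pos; [lra|apply Rdiv_lt_0_compat; trivial]. }
  (* The bound [1] on [|h - h0|] gives [(h - h0)^2 <= |h - h0|], and the bound
     [c / K] then gives [u 0 * K < c]. *)
  exists (mkposreal _ Hd); intros h Hh HDh.
  change (Rabs (h - h0) < Rmin 1 (c / K)) in Hh.
  destruct (Hinit h HDh) as [Hx0 Hy0]; specialize (Hcurve h HDh).
  set (u := fun s => (x h s - a) ^ 2 + (y h s - b) ^ 2 + (h - h0) ^ 2).
  set (du := fun s => 2 * (x h s - a) * F (x h s) (y h s) h
                      + 2 * (y h s - b) * G (x h s) (y h s) h).
  assert (Hsmall : forall s, u s <= c ->
    Rabs (x h s - a) < rho /\ Rabs (y h s - b) < rho /\ Rabs (h - h0) < rho).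
  { intros s Hs; unfold u, c in Hs.
    assert (S1 := pow2_ge_0 (x h s - a)).
    assert (S2 := pow2_ge_0 (y h s - b)).
    assert (S3 := pow2_ge_0 (h - h0)).
    assert (S4 : 0 < rho * rho) by nra.
    repeat split; rewrite <- (Rabs_pos_eq rho) by lra;
      apply Rsqr_lt_abs_0; unfold Rsqr; lra. }
  assert (Hu0 : u 0 = (h - h0) ^ 2).
  { unfold u; rewrite Hx0, Hy0; ring. }
  assert (Hlt : u 0 * K < c).
  { rewrite Hu0.
    assert (H1 : Rabs (h - h0) < 1) by
      (eapply Rlt_le_trans; [exact Hh|apply Rmin_l]).
    assert (H2 : Rabs (h - h0) < c / K) by
      (eapply Rlt_le_trans; [exact Hh|apply Rmin_r]).
    assert (H3 : Rabs (h - h0) * K < c).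
    { apply Rmult_lt_compat_r with (r := K) in H2; trivial.
      unfold Rdiv in H2; rewrite Rmult_assoc, Rinv_l in H2 by lra; lra. }
    rewrite <- pow2_abs.
    assert (P := Rabs_pos (h - h0)).
    apply Rle_lt_trans with (2 := H3), Rmult_le_compat_r; nra. }
  intros s Hs.
  assert (Hus : u s <= c).
  { apply Rlt_le, Rle_lt_trans with (2 := Hlt).
    apply (gronwall u du C c T); trivial.
    - intros t; destruct (Hcurve t) as (_ & Dx & Dy); unfold u, du.
      auto_derive.
      + repeat split; eexists; [apply Dx|apply Dy].
      + replace (Derive (fun v => x h v) t) with (F (x h t) (y h t) h)
          by (symmetry; apply is_derive_unique, Dx).
        replace (Derive (fun v => y h v) t) with (G (x h t) (y h t) h)
          by (symmetry; apply is_derive_unique, Dy).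
        ring.
    - intros t Ht; destruct (Hsmall t Ht) as (T1 & T2 & T3).
      specialize (BF (x h t) (y h t) h ltac:(lra) ltac:(lra) ltac:(lra)).
      specialize (BG (x h t) (y h t) h ltac:(lra) ltac:(lra) ltac:(lra)).
      rewrite F0, Rminus_0_r in BF; rewrite G0, Rminus_0_r in BG.
      unfold du, u, C.
      rewrite <- (pow2_abs (x h t - a)), <- (pow2_abs (y h t - b)),
        <- (pow2_abs (h - h0)).
      eapply Rle_trans; [apply Rabs_triang|].
      rewrite !Rabs_mult, (Rabs_pos_eq 2) by lra.
      assert (P1 := Rabs_pos (x h t - a)).
      assert (P2 := Rabs_pos (y h t - b)).
      assert (P3 := Rabs_pos (h - h0)).
      revert BF BG P1 P2 P3; clear -HLF HLG.
      generalize (Rabs (x h t - a)) (Rabs (y h t - b)) (Rabs (h - h0))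
        (Rabs (F (x h t) (y h t) h)) (Rabs (G (x h t) (y h t) h)).
      intros X Y H f g BF BG P1 P2 P3.
      set (S := X + Y + H) in *.
      assert (Q1 : X * f <= S * (LF * S)) by
        (apply Rle_trans with (X * (LF * S));
         [apply Rmult_le_compat_l; trivial
         |apply Rmult_le_compat_r; [apply Rmult_le_pos|]; unfold S; lra]).
      assert (Q2 : Y * g <= S * (LG * S)) by
        (apply Rle_trans with (Y * (LG * S));
         [apply Rmult_le_compat_l; trivial
         |apply Rmult_le_compat_r; [apply Rmult_le_pos|]; unfold S; lra]).
      assert (Q3 : S * S <= 3 * (X ^ 2 + Y ^ 2 + H ^ 2)).
      { assert (0 <= (X - Y) ^ 2 + (Y - H) ^ 2 + (X - H) ^ 2)
          by (repeat apply Rplus_le_le_0_compat; apply pow2_ge_0).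
        unfold S; lra. }
      assert (Q4 := Rmult_le_compat_l (LF + LG) _ _ ltac:(lra) Q3).
      lra.
    - rewrite Hu0; apply pow2_ge_0. }
  destruct (Hsmall s Hus) as (T1 & T2 & T3); lra.
Qed.

Lemma filter_forall_le {T : Type} (Fl : (T -> Prop) -> Prop) {FF : Filter Fl}
    (P : nat -> T -> Prop) :
  (forall j, Fl (P j)) ->
  forall k, Fl (fun t => forall j, (j <= k)%nat -> P j t).
Proof.
  intros HP k; induction k as [|k IH].
  - apply filter_imp with (2 := HP 0%nat).
    intros t Ht j Hj; replace j with 0%nat by lia; exact Ht.
  - apply filter_imp with (2 := filter_and _ _ IH (HP (S k))).
    intros t [H1 H2] j Hj.
    destruct (Nat.eq_dec j (S k)) as [->|]; [exact H2|apply H1; lia].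
Qed.

(** The observable [P] is arbitrary because differentiating a coordinate along
    the solution produces general smooth functions of [(x, y, h)]; the
    coordinates themselves are the case of interest. *)
Lemma Ck_cvg_to_equilibrium (U : R * R * R -> Prop) F G P (D : R -> Prop)
    (a b h0 : R)    (x y : R -> R -> R) :
  open U -> smooth3_on U F -> smooth3_on U G -> smooth3_on U P -> D h0 ->
  (forall h, D h -> integral_curve U F G h (x h) (y h)) ->
  (forall h, D h -> x h 0 = a /\ y h 0 = b) ->
  (forall s, x h0 s = a /\ y h0 s = b) ->
  forall k, Ck_cvg_on_compacts k D h0
    (fun h s => P (x h s) (y h s) h) (fun s => P (x h0 s) (y h0 s) h0).
Proof.
  intros HU HF HG HP HD Hcurve Hinit Hconst k.
  split; [|split].
  1: intros h Hh; apply (is_Ck_integral_curve U F G); auto.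
  1: apply (is_Ck_integral_curve U F G P h0); auto.
  intros K eps HK Heps.
  destruct (compact_P1 K HK) as (m & M & HmM).
  destruct (Hcurve h0 HD 0) as (Hp & Dx & Dy).
  destruct (Hconst 0) as [Ex Ey]; rewrite Ex, Ey in Hp, Dx, Dy.
  assert (F0 : F a b h0 = 0).
  { rewrite <- (is_derive_unique _ _ _ Dx).
    transitivity (Derive (fun _ => a) 0); [|apply (Derive_const a)].
    apply Derive_ext; intros t; apply Hconst. }
  assert (G0 : G a b h0 = 0).
  { rewrite <- (is_derive_unique _ _ _ Dy).
    transitivity (Derive (fun _ => b) 0); [|apply (Derive_const b)].
    apply Derive_ext; intros t; apply Hconst. }
  assert (Hj : forall j, within D (locally h0) (fun h => forall s, K s ->
    Rabs (Derive_n (fun s => P (x h s) (y h s) h) j s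
          - Derive_n (fun s => P (x h0 s) (y h0 s) h0) j s) < eps)).
  { intros j.
    assert (Hlie := smooth3_on_iter_lie U F G P HU HF HG HP j 0%nat).
    destruct (continuous_near _ _ _ _
      (Ck3_on_continuous _ _ _ _ _ _ Hlie Hp) eps Heps) as (r & Hr & B).
    assert (H := uniform_convergence_to_equilibrium U F G D a b h0 x y HU
      (HF 1%nat) (HG 1%nat) Hp F0 G0 Hcurve Hinit (Rabs m + Rabs M) r
      (Rplus_le_le_0_compat _ _ (Rabs_pos m) (Rabs_pos M)) Hr).
    revert H; unfold within; apply filter_imp; intros h H Hh s Hs.
    rewrite (Derive_n_integral_curve U F G P h) by auto.
    rewrite (Derive_n_integral_curve U F G P h0) by auto.
    destruct (Hconst s) as [-> ->].
    destruct (H Hh s) as (H1 & H2 & H3); [|apply B; trivial].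
    specialize (HmM s Hs).
    assert (B1 := Rle_abs M); assert (B2 := Rle_abs (- m)).
    rewrite Rabs_Ropp in B2.
    assert (P1 := Rabs_pos m); assert (P2 := Rabs_pos M).
    apply Rabs_le; lra. }
  generalize (filter_forall_le (within D (locally h0)) _ Hj k).
  apply filter_imp; intros h H j s Hjk Hs; apply H; trivial.
Qed.

Theorem theorem4p11 (Phi : R -> R -> R -> R) (A : R) (tau nu : R -> R -> R)
    (HPhi : smooth3_on punctured_space Phi)
    (HA : A <> 0)
    (Hsol : forall h : R, 0 <= h -> is_solution Phi A h (tau h) (nu h))
    (Hconst : forall s : R, tau 0 s = 0 /\ nu 0 s = A) :
  forall k : nat,
    Ck_cvg_on_compacts k (fun h : R => 0 <= h) 0 tau (tau 0) /\
    Ck_cvg_on_compacts k (fun h : R => 0 <= h) 0 nu (nu 0).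
Proof.
  assert (HU := open_punctured_space).
  set (F := fun x y z => 1 + y * Phi x y z).
  set (G := fun x y z => -1 * x * Phi x y z).
  assert (HF : smooth3_on punctured_space F).
  { intros k; apply Ck3_on_plus; [exact HU|apply Ck3_on_const, HU|].
    apply Ck3_on_mult; [exact HU|apply Ck3_on_snd, HU|apply HPhi]. }
  assert (HG : smooth3_on punctured_space G).
  { intros k; apply Ck3_on_mult; [exact HU| |apply HPhi].
    apply Ck3_on_mult; [exact HU|apply Ck3_on_const, HU|apply Ck3_on_fst, HU]. }
  assert (Hcurve : forall h, 0 <= h ->
    integral_curve punctured_space F G h (tau h) (nu h)).
  { intros h Hh s; destruct (Hsol h Hh) as [H _].
    destruct (H s) as (H1 & H2 & H3); split; [exact H1|split; [exact H2|]].
    unfold G; replace (-1 * tau h s) with (- tau h s) by ring; exact H3. }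
  assert (Hinit : forall h, 0 <= h -> tau h 0 = 0 /\ nu h 0 = A).
  { intros h Hh; apply (Hsol h Hh). }
  intros k; split.
  - exact (Ck_cvg_to_equilibrium punctured_space F G (fun x _ _ => x) _ 0 A 0
      tau nu HU HF HG (fun k => Ck3_on_fst k _ HU) (Rle_refl 0)
      Hcurve Hinit Hconst k).
  - exact (Ck_cvg_to_equilibrium punctured_space F G (fun _ y _ => y) _ 0 A 0
      tau nu HU HF HG (fun k => Ck3_on_snd k _ HU) (Rle_refl 0)
      Hcurve Hinit Hconst k).
Qed.
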